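(* When a melody $\mathbf{x}=(x_1,\dots,x_{n+1})$ begins and ends with one and the same note (i.e. $x_1=x_{n+1}$), $\mathbf{x}$ and its retrograde $\mathbf{x}^r$ have the same slope, i.e. $s(M(\mathbf{x}^r))=s(M(\mathbf{x}))$.
   Context: A melody is a finite sequence of integers $\mathbf{x}=(x_1,\dots,x_{n+1})$, each integer representing a note. Its M-graph $M(\mathbf{x})$ is the directed graph whose vertices are the sequence of points $p_i=(x_i,x_{i+1})\in\mathbb{R}^2$, $1\leq i\leq n$, and whose edges are $(p_i,p_{i+1})$, $1\leq i\leq n-1$. The slope of the melody $\mathbf{x}$ is the slope $s(M(\mathbf{x}))$ of the line fitted to the points $p_1,\dots,p_n$ by the method of least squares; for points $(x_1,y_1),\dots,(x_N,y_N)$ in $\mathbb{R}^2$ this slope is given by $\dfrac{N\sum_{i=1}^N x_iy_i-\sum_{i=1}^N x_i\sum_{i=1}^N y_i}{N\sum_{i=1}^N x_i^2-\left(\sum_{i=1}^N x_i\right)^2}$, applied here with $N=n$ and $y_i=x_{i+1}$. The retrograde of $\mathbf{x}$ is $\mathbf{x}^r=(x_{n+1},\dots,x_1)$. *)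

(* Defs.v *)
From HB Require Import structures.
From mathcomp Require Import all_boot all_order all_algebra.
From mathcomp Require Import reals.

Set Implicit Arguments.
Unset Strict Implicit.
Unset Printing Implicit Defensive.

Import Order.TTheory GRing.Theory Num.Theory.
Local Open Scope ring_scope.

(* [zip] truncates: (s_1, ..., s_m) gives (s_1, s_2), ..., (s_(m-1), s_m). *)
Definition consecutive (T : Type) (s : seq T) : seq (T * T) :=
  zip s (behead s).

(* Vertices and edges form sequences, not sets: a point visited several times
   by a melody counts with its multiplicity in the least-squares fit. *)
Record digraph (T : Type) := Digraph {
  vertices : seq T;
  edges : seq (T * T)
}.

Definition melody_points (R : realType) (x : seq int) : seq (R * R) :=
  [seq (p.1%:~R, p.2%:~R) | p <- consecutive x].

Definition mgraph (R : realType) (x : seq int) : digraph (R * R) :=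
  Digraph (melody_points R x) (consecutive (melody_points R x)).

Definition ls_num (R : realType) (s : seq (R * R)) : R :=
  (size s)%:R * (\sum_(p <- s) p.1 * p.2)
  - (\sum_(p <- s) p.1) * (\sum_(p <- s) p.2).

Definition ls_den (R : realType) (s : seq (R * R)) : R :=
  (size s)%:R * (\sum_(p <- s) p.1 ^+ 2) - (\sum_(p <- s) p.1) ^+ 2.

(* [None] when the denominator vanishes, that is, when the points have a single
   abscissa (or there are none), so that no slope is defined. *)
Definition ls_slope (R : realType) (s : seq (R * R)) : option R :=
  if ls_den s == 0 then None else Some (ls_num s / ls_den s).

Definition graph_slope (R : realType) (G : digraph (R * R)) : option R :=
  ls_slope (vertices G).

Definition retrograde (x : seq int) : seq int := rev x.

(* Main.v *)
Require Import Defs.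
From mathcomp Require Import all_boot all_order all_algebra.
From mathcomp Require Import reals.

(** Reversing a melody reflects the points of its M-graph in the diagonal. The
    numerator of the least-squares slope is symmetric in the two coordinates;
    the denominator involves only the sums of the abscissas and of their
    squares, and when the melody is closed the abscissas and the ordinates of
    the points form the same multiset. *)

Import GRing.Theory.
Local Open Scope ring_scope.

(** Needed because [rev] turns the cons of an induction into [rcons]. *)
Lemma consecutive_rcons (T : Type) (s : seq T) (b a : T) :
  consecutive (rcons (rcons s b) a) = rcons (consecutive (rcons s b)) (b, a).
Proof.
elim: s => [|c [|d s] IHs] //.
by move: IHs; rewrite /consecutive /= => ->.
Qed.

Lemma consecutive_rev (T : Type) (s : seq T) :
  consecutive (rev s) = rev [seq (p.2, p.1) | p <- consecutive s].
Proof.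
elim: s => [|a [|b s] IHs] //.
by rewrite rev_cons rev_cons consecutive_rcons -rev_cons IHs -rev_cons.
Qed.

(** The difference of the two sums telescopes to the value of [f] at the last note minus that at the
    first. *)
Lemma sum_consecutive_closed (T : Type) (V : zmodType) (f : T -> V)
    (a : T) (s : seq T) :
  last a s = a ->
  \sum_(p <- consecutive (a :: s)) f p.2 = \sum_(p <- consecutive (a :: s)) f p.1.
Proof.
move=> closed; apply/subr0_eq; rewrite -sumrB.
(* Closedness is dropped before the induction, since the tail of a closed melody need not be
   closed. *)
suff -> : \sum_(p <- consecutive (a :: s)) (f p.2 - f p.1) = f (last a s) - f a.
  by rewrite closed subrr.
elim: s a {closed} => [|b s IHs] a; first by rewrite big_nil subrr.
by rewrite big_cons [X in _ + X]IHs addrC addrA subrK.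
Qed.

Lemma melody_points_rev (R : realType) (x : seq int) :
  melody_points R (rev x) = rev [seq (p.2, p.1) | p <- melody_points R x].
Proof. by rewrite /melody_points consecutive_rev map_rev -!map_comp. Qed.

Lemma ls_slope_rev_swap (R : realType) (s : seq (R * R)) :
  \sum_(p <- s) p.2 = \sum_(p <- s) p.1 ->
  \sum_(p <- s) p.2 ^+ 2 = \sum_(p <- s) p.1 ^+ 2 ->
  ls_slope (rev [seq (p.2, p.1) | p <- s]) = ls_slope s.
Proof.
move=> eq_sum eq_sumsq.
have num_eq : ls_num (rev [seq (p.2, p.1) | p <- s]) = ls_num s.
  rewrite /ls_num size_rev size_map !big_rev !big_map /=.
  by rewrite [X in _ - X]mulrC; under eq_bigr do rewrite mulrC.
have den_eq : ls_den (rev [seq (p.2, p.1) | p <- s]) = ls_den s.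
  by rewrite /ls_den size_rev size_map !big_rev !big_map /= eq_sum eq_sumsq.
(* Equal denominators vanish together, so the [None] case agrees as well. *)
by rewrite /ls_slope num_eq den_eq.
Qed.

Theorem corollary1p2 (R : realType) (n : nat) (x : n.+1.-tuple int)
  (hx : tnth x ord0 = tnth x ord_max) :
  graph_slope (mgraph R (retrograde x)) = graph_slope (mgraph R x).
Proof.
rewrite /graph_slope /= /retrograde melody_points_rev.
case: x hx => [[|a s] //= size_s]; rewrite !(tnth_nth a) /= => closed.
have last_s : last a s = a.
  (* Here [s] has size [n], so the entry of [a :: s] at index [ord_max] is its last one. *)
  by move: size_s => /eqP [size_s]; rewrite [RHS]closed (last_nth a) size_s.
apply: ls_slope_rev_swap; rewrite !big_map /=.
  exact: (sum_consecutive_closed _ _ (fun z : int => z%:~R : R) _ _ last_s).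
exact: (sum_consecutive_closed _ _ (fun z : int => z%:~R ^+ 2 : R) _ _ last_s).
Qed.
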